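(* Let $G$ be an amenable group and let $\mathcal{F} = (F_j)_{j \in J}$ be a Følner net for $G$. Let $A$ and $B$ be two finite sets. Suppose that $X \subset A^G$ and $Y \subset B^G$ are subshifts with $X$ strongly irreducible. Let $\tau \colon X \to Y$ be a pre-injective cellular automaton. Then $\operatorname{ent}_{\mathcal{F}}(\tau(X)) = \operatorname{ent}_{\mathcal{F}}(X)$.
   Context: $A^G$ is the set of all maps $x \colon G \to A$ with the product of the discrete topologies; $G$ acts by $(gx)(h) = x(g^{-1}h)$. A subshift is a closed $G$-invariant subset. For $\Omega \subset G$, $x|_\Omega$ is the restriction and $X_\Omega = \{x|_\Omega : x \in X\} \subset A^\Omega$. For $\Omega,\Delta \subset G$ put $\Omega^{+\Delta} = \{g \in G : g\Delta \cap \Omega \neq \varnothing\} = \Omega\Delta^{-1}$. A subshift $X$ is strongly irreducible if there is a finite $\Delta \subset G$ such that for all finite $\Omega_1,\Omega_2 \subset G$ with $\Omega_1^{+\Delta} \cap \Omega_2 = \varnothing$ and all $x_1,x_2 \in X$ there is $x \in X$ with $x|_{\Omega_1} = x_1|_{\Omega_1}$ and $x|_{\Omega_2} = x_2|_{\Omega_2}$. A cellular automaton between subshifts is a continuous $G$-equivariant map. It is pre-injective if $\tau(x_1)=\tau(x_2)$ implies $x_1=x_2$ whenever $x_1,x_2 \in X$ coincide outside a finite subset of $G$. A Følner net for $G$ is a family $\mathcal{F} = (F_j)_{j\in J}$ of nonempty finite subsets of $G$ indexed by a directed set $J$ such that $\lim_j |F_j^{+E}\setminus F_j|/|F_j| =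 0$ for every finite $E \subset G$; $G$ is amenable if it admits one. The entropy of a subset $X \subset A^G$ is $\operatorname{ent}_{\mathcal{F}}(X) = \limsup_j \frac{\log |X_{F_j}|}{|F_j|}$ (with $\log 0 = -\infty$). *)

(* Defs.v *)
From HB Require Import structures.
From mathcomp Require Import all_boot all_order all_algebra finmap.
From mathcomp Require Import all_classical all_reals all_analysis.

Set Implicit Arguments.
Unset Strict Implicit.
Unset Printing Implicit Defensive.

Import Order.TTheory GRing.Theory Num.Theory.
Import numFieldNormedType.Exports.

Local Open Scope classical_set_scope.
Local Open Scope ring_scope.

Notation config G A := {ptws G -> discrete_topology A}.

Section Shifts.
Variable G : groupType.

Definition translate (A : finType) (g : G) (x : config G A) : config G A :=
  fun h => x (g^-1 * h)%g.

Definition restr (A : finType) (W : {fset G}) (x : config G A) :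
    {ffun W -> A} :=
  [ffun h : W => x (val h)].

Definition patterns (A : finType) (X : set (config G A)) (W : {fset G}) :
    set {ffun W -> A} :=
  restr W @` X.

(* W^{+D} = W D^-1 = {g | g D meets W}; the second equality is thickenP. *)
Definition thicken (W D : {fset G}) : {fset G} :=
  [fset (w * d^-1)%g | w in W, d in D]%fset.

Lemma thickenP (W D : {fset G}) (g : G) :
  g \in thicken W D <-> exists2 d, d \in D & (g * d)%g \in W.
Proof.
split.
  case/imfset2P => /= w wW [d dD ->]; exists d => //.
  by rewrite mulgVK.
case=> d dD gdW; apply/imfset2P; exists (g * d)%g => //; exists d => //.
by rewrite mulgK.
Qed.

Definition subshift (A : finType) (X : set (config G A)) : Prop :=
  closed X /\ forall g x, X x -> X (translate g x).

Definition strongly_irreducible (A : finType) (X : set (config G A)) : Prop :=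
  exists D : {fset G}, forall W1 W2 : {fset G},
    [disjoint thicken W1 D & W2]%fset ->
    forall x1 x2, X x1 -> X x2 ->
    exists x, [/\ X x, restr W1 x = restr W1 x1 & restr W2 x = restr W2 x2].

(* X and Y are coerced to types carrying the subspace topology.  When X is a
   subshift, the only x' satisfying the premise of the second conjunct is
   the translate of x by g, seen as a point of X. *)
Definition cellular_automaton (A B : finType)
    (X : set (config G A)) (Y : set (config G B)) (tau : X -> Y) : Prop :=
  continuous tau /\
  forall (g : G) (x x' : X), set_val x' = translate g (set_val x) ->
    set_val (tau x') = translate g (set_val (tau x)).

Definition pre_injective (A B : finType)
    (X : set (config G A)) (Y : set (config G B)) (tau : X -> Y) : Prop :=
  forall x1 x2 : X,
    (exists W : {fset G}, forall h, h \notin W ->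
       (set_val x1 : config G A) h = (set_val x2 : config G A) h) ->
    tau x1 = tau x2 -> x1 = x2.

End Shifts.

Arguments patterns {G A} X W.

Definition directed_set (d : Order.disp_t) (J : preorderType d) : Prop :=
  inhabited J /\ forall i j : J, exists k : J, (i <= k)%O /\ (j <= k)%O.

Definition net_filter (d : Order.disp_t) (J : preorderType d) : set_system J :=
  filter_from setT (fun i : J => [set j | (i <= j)%O]).

Arguments net_filter {d} J.

Definition Folner_net (R : realType) (G : groupType) (d : Order.disp_t)
    (J : preorderType d) (F : J -> {fset G}) : Prop :=
  [/\ directed_set J,
      forall j, F j != fset0 &
      forall E : {fset G},
        (fun j => #|` (thicken (F j) E `\` F j)%fset|%:R / #|` F j|%:R : R)
          @ net_filter J --> (0 : R)].

Definition amenable (R : realType) (G : groupType) : Prop :=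
  exists (d : Order.disp_t) (J : preorderType d) (F : J -> {fset G}),
    Folner_net R F.

(* limf_esup asks for a neighbourhood structure on the index type but does not
   depend on it; the discrete one is supplied.  lne 0 = -oo. *)
Definition entropy (R : realType) (G : groupType) (d : Order.disp_t)
    (J : preorderType d) (F : J -> {fset G}) (A : finType)
    (X : set (config G A)) : \bar R :=
  limf_esup
    (fun j : discrete_topology J =>
       lne (#|patterns X (F j)|%:R%:E) / #|` F j|%:R%:E)%E
    (net_filter J).

(* Main.v *)
(* A pattern p of X on a finite window W extends to a point of X that agrees
   with a fixed x0 in X outside W^{+D}, by strong irreducibility and
   compactness.
   The points obtained for different p differ only on finite sets, so by
   pre-injectivity their images under tau are distinct; by locality of tau these
   images agree outside W^{+E} for a finite E independent of W.  Hence
   |X_W| <= |tau(X)_{W^{+E}}|, while locality alone gives the analogous bound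
   |tau(X)_W| <= |X_{W^{+E'}}|.  Along a Folner net, enlarging the window from W
   to W^{+E} does not change the entropy, so both inequalities between the
   entropies follow. *)
Require Import Defs.
From mathcomp Require Import all_boot all_order all_algebra finmap.
From mathcomp Require Import all_classical all_reals all_analysis.

Set Implicit Arguments.
Unset Strict Implicit.
Unset Printing Implicit Defensive.

Import Order.TTheory GRing.Theory Num.Theory.
Import numFieldNormedType.Exports.

Local Open Scope classical_set_scope.
Local Open Scope ring_scope.

Section ConfigurationSpace.
Variables (G : groupType) (A : finType).
Implicit Types (x y : config G A) (W M : {fset G}).

Definition agree W x y := forall h, h \in W -> x h = y h.

Lemma restr_eqP W x y : restr W x = restr W y <-> agree W x y.
Proof.
split=> [/ffunP e h hW|e].
  by have := e (FSetSub hW); rewrite !ffunE.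
by apply/ffunP => h; rewrite !ffunE; exact/e/valP.
Qed.

Lemma agree_near W x : \forall y \near x, agree W y x.
Proof.
have coord h : \forall y \near x, y h = x h.
  have := @proj_continuous G (fun=> discrete_topology A) h x.
  by move=> /(_ _ (discrete_set1 _)).
suff: \forall y \near x, forall h, h \in enum_fset W -> y h = x h by [].
have nF : Filter (nbhs x) := @nbhs_filter (config G A) x.
elim: (enum_fset W) => [|g s IH]; first exact: filterE.
apply: filterS2 IH (coord g) => y ys yg h.
by rewrite inE => /orP[/eqP -> //|/ys].
Qed.

Lemma closed_config_compact (K : set (config G A)) : closed K -> compact K.
Proof.
move=> clK; apply: (subclosed_compact clK _ (@subsetT _ K)).
have -> : [set: config G A] = [set f | forall i, [set: discrete_topology A] (f i)].
  by apply/seteqP; split.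
apply: (@tychonoff G (fun=> discrete_topology A) (fun=> setT)) => i.
by apply: finite_compact; exact: (@finite_finset A).
Qed.

(** Near this filter means for all large enough finite windows, the form in which near-covering
    compactness yields a single window. *)
Definition window_filter : set_system {fset G} :=
  filter_from setT (fun M => [set M' | M `<=` M']%fset).

Lemma window_filter_filter : Filter window_filter.
Proof.
apply: filter_fromT_filter; first by exists fset0.
by move=> M N; exists (M `|` N)%fset => P; rewrite /= fsubUset => /andP.
Qed.

(* [P M x] is meant to be monotone in M: if it holds locally uniformly once M is
   large, then a single M works on the whole closed set. *)
Lemma closed_window_cover (K : set (config G A))
    (P : {fset G} -> config G A -> Prop) :
  closed K ->
  (forall x, K x -> exists M, forall M' y,
     (M `<=` M')%fset -> agree M y x -> P M' y) ->
  exists M, forall x, K x -> P M x.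
Proof.
move=> /closed_config_compact/compact_near_coveringP Kcov KP.
have [x Kx|M _ KM] := Kcov _ _ P window_filter_filter.
  have [M PM] := KP x Kx.
  exists ([set y | agree M y x], [set M' | M `<=` M']%fset).
    by split; [exact: agree_near|exists M].
  by case=> y M' /= [yx MM']; exact: PM.
by exists M => x Kx; apply: (KM M) => /=.
Qed.

(* Compactness of the complement of U replaces the description of the basic
   open sets of the product topology. *)
Lemma open_cylinder (U : set (config G A)) x :
  open U -> U x -> exists M, forall y, agree M y x -> U y.
Proof.
move=> oU Ux; have [||M HM] := @closed_window_cover (~` U) (fun M y => ~ agree M y x).
- exact: open_closedC.
- move=> y Uy; have [h yxh] : exists h, y h <> x h.
    by apply/existsNP => yx; apply: Uy; rewrite (_ : y = x)//; exact/funext.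
  exists [fset h]%fset => M z hM zy zx; apply: yxh.
  rewrite -(zy h) ?inE// zx//; apply: (fsubsetP hM); exact: fset11.
by exists M => y yx; apply: contrapT => /HM.
Qed.

End ConfigurationSpace.

(** If no such point existed, each point of [X] would fail at some coordinate, and by compactness
    one finite [M] would detect all these failures. Gluing on [W] and on the part of [M] outside
    [thicken W D] contradicts this. *)
Lemma strongly_irreducible_extend (G : groupType) (A : finType)
    (X : set (config G A)) :
  closed X -> strongly_irreducible X ->
  exists D : {fset G}, forall (W : {fset G}) x1 x0, X x1 -> X x0 ->
  exists x, [/\ X x, agree W x x1 & forall h, h \notin thicken W D -> x h = x0 h].
Proof.
move=> clX [D irr]; exists D => W x1 x0 X1 X0; apply: contrapT => none.
pose P (M : {fset G}) (x : config G A) :=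
  ~ (agree W x x1 /\ agree (M `\` thicken W D)%fset x x0).
have [x Xx|M HM] := closed_window_cover (P := P) clX.
  apply: contrapT => noM; apply: none; exists x; split => //.
    move=> h hW; apply: contrapT => xh; apply: noM; exists [fset h]%fset.
    move=> M y _ yx [+ _] => /(_ h hW) yh; apply: xh.
    by rewrite -yx ?yh ?fset11.
  move=> h hW; apply: contrapT => xh; apply: noM; exists [fset h]%fset.
  move=> M y hM yx [_ /(_ h)]; rewrite yx ?fset11// => e; apply/xh/e.
  by rewrite inE hW/=; apply: (fsubsetP hM); exact: fset11.
have [|x [Xx xW xM]] := irr W (M `\` thicken W D)%fset _ x1 x0 X1 X0.
  by apply/fdisjointP => g gW; rewrite inE gW.
by apply: (HM x Xx); split; exact/restr_eqP.
Qed.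

(* Curtis-Hedlund-Lyndon. *)
Lemma local_rule (G : groupType) (A B : finType)
    (X : set (config G A)) (Y : set (config G B)) (tau : X -> Y) :
  subshift X -> cellular_automaton tau ->
  exists M : {fset G}, forall (u v : X) g,
    (forall m, m \in M ->
       (set_val u : config G A) (g * m)%g = (set_val v : config G A) (g * m)%g) ->
    (set_val (tau u) : config G B) g = (set_val (tau v) : config G B) g.
Proof.
move=> [clX shX] [ctau eqv].
(* By equivariance it suffices to find a window for the value at the identity. *)
pose out (u : X) : B := (set_val (tau u) : config G B) 1%g.
pose P (M : {fset G}) (x : config G A) := forall u v : X,
  set_val u = x -> agree M (set_val u) (set_val v) -> out u = out v.
have [x Xx|M HM] := closed_window_cover (P := P) clX.
  pose u0 : X := exist _ x (mem_set Xx).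
  have [W oW [Wx WU]] : exists2 W : set (config G A), open W &
      W x /\ forall u : X, W (set_val u) -> out u = out u0.
    have near1 : nbhs (set_val (tau u0) : config G B)
        [set y : config G B | y 1%g = out u0].
      have := agree_near [fset 1%g]%fset (set_val (tau u0) : config G B).
      have nF := @nbhs_filter (config G B) (set_val (tau u0)).
      by apply: filterS => y; apply; rewrite fset11.
    have := ctau u0 _ (@initial_continuous Y (config G B) set_val _ _ near1).
    by move=> [_ [[W oW <-] Wx WU]]; exists W => //.
  have [M HM] := open_cylinder oW Wx; exists M => M' y MM' yx u v uy uv.
  rewrite (WU u) ?(WU v)//; apply: HM => h hM; last by rewrite uy yx.
  by rewrite -uv ?uy ?yx//; exact: (fsubsetP MM').
exists M => u v g uv.
have tr (w : X) : exists w' : X, set_val w' = translate g^-1%g (set_val w).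
  have Xw := shX g^-1%g _ (set_valP w).
  by exists (exist (fun x => x \in X) _ (mem_set Xw)).
have [u' eu] := tr u; have [v' ev] := tr v.
have at1 (w w' : X) : set_val w' = translate g^-1%g (set_val w) ->
    out w' = (set_val (tau w) : config G B) g.
  by move=> /eqv e; rewrite /out e /translate invgK mulg1.
rewrite -(at1 _ _ eu) -(at1 _ _ ev); apply: (HM (set_val u')) => //.
  exact: set_valP.
by move=> m mM; rewrite eu ev /translate invgK uv.
Qed.

(** A choice of [t] for each [s] is injective. The relational form lets patterns be matched through
    a configuration that restricts to both. *)
Lemma card_le_rel (S T : finType) (P : {pred S}) (Q : {pred T})
    (r : S -> T -> Prop) :
  (forall s, s \in P -> exists2 t, t \in Q & r s t) ->
  (forall s s' t, r s t -> r s' t -> s = s') ->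
  (#|P| <= #|Q|)%N.
Proof.
move=> rP r_inj.
have /choice[f fP] (s : {s | s \in P}) : exists t, t \in Q /\ r (sval s) t.
  by case: s => s sP; have [t] := rP s sP; exists t.
rewrite -(card_sig P) -(card_imset predT (f := f)).
  by apply: subset_leq_card; apply/fintype.subsetP => _ /imsetP[s _ ->]; case: (fP s).
move=> s s' fss'; apply: val_inj; apply: (r_inj _ _ (f s)); first exact: (fP s).2.
by rewrite fss'; exact: (fP s').2.
Qed.

(** A pattern on [V] is determined by its restrictions to [W] and to [V \ W], the latter having at
    most [#|A|] letters per site. *)
Lemma card_patterns_fsetD (G : groupType) (A : finType) (X : set (config G A))
    (V W : {fset G}) :
  (#|patterns X V| <= #|patterns X W| * #|A| ^ #|` (V `\` W)%fset|)%N.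
Proof.
have -> : (#|A| ^ #|` (V `\` W)%fset| = #|[pred p : {ffun (V `\` W)%fset -> A} | true]|)%N.
  by rewrite cardfE -card_ffun.
rewrite -cardX.
apply: (card_le_rel (r := fun p q => exists2 x,
  restr V x = p & (restr W x, restr (V `\` W)%fset x) = q)).
  move=> _ /set_mem[x Xx <-]; exists (restr W x, restr (V `\` W)%fset x); last by exists x.
  by rewrite !inE/= andbT; apply/mem_set; exists x.
move=> _ _ _ [x <- <-] [y <- [/restr_eqP yxW /restr_eqP yxV]].
apply/restr_eqP => h hV; have [hW|hW] := boolP (h \in W); first by rewrite yxW.
by rewrite yxV// inE hW.
Qed.

Lemma limf_esup_le_near (R : realType) (T : choiceType) (X : filteredType T)
    (f g : X -> \bar R) (F : set_system X) {FF : Filter F} :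
  (forall e : R, 0 < e -> \forall x \near F, (f x <= g x + e%:E)%E) ->
  (limf_esup f F <= limf_esup g F)%E.
Proof.
move=> fg; apply/lee_addgt0Pr => e e0; rewrite -leeBlDr//.
apply: le_ereal_inf_tmp => _ [V FV <-]; rewrite leeBlDr//.
(* Cutting [V] down to the points where the bound holds leaves a set of the filter. *)
apply: (@le_trans _ _ (ereal_sup (f @` (V `&` [set x | (f x <= g x + e%:E)%E])))).
  by apply: ereal_inf_lbound; eexists; [|reflexivity]; apply: filterI (fg e e0).
apply: ge_ereal_sup => _ [x [Vx fgx] <-]; apply: (le_trans fgx).
by rewrite leeD2r//; apply: ereal_sup_ubound; exists x.
Qed.

Lemma net_filter_filter (d : Order.disp_t) (J : preorderType d) :
  directed_set J -> Filter (net_filter J).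
Proof.
move=> [[j0] dirJ]; apply: filter_fromT_filter; first by exists j0.
move=> i j; have [k [ik jk]] := dirJ i j; exists k => l /= kl.
by split; [exact: le_trans ik kl|exact: le_trans jk kl].
Qed.

(** The sites added to [F j] cost a bounded factor each, and the Folner condition makes their number
    negligible against the size of [F j]. *)
Lemma entropy_le_thicken (R : realType) (G : groupType) (d : Order.disp_t)
    (J : preorderType d) (F : J -> {fset G}) (A B : finType)
    (X : set (config G A)) (Y : set (config G B)) (E : {fset G}) :
  Folner_net R F ->
  (forall W, #|patterns X W| <= #|patterns Y (thicken W E)|)%N ->
  (entropy R F X <= entropy R F Y)%E.
Proof.
move=> [dirJ F0 FE] XY; have nF := net_filter_filter dirJ.
(* The [.+1] keeps the base positive when B is empty. *)
pose c : R := ln #|B|.+1%:R.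
pose k j : R := #|` (thicken (F j) E `\` F j)%fset|%:R / #|` F j|%:R.
have step j : (lne (#|patterns X (F j)|%:R%:E : \bar R) / #|` F j|%:R%:E <=
    lne (#|patterns Y (F j)|%:R%:E) / #|` F j|%:R%:E + (c * k j)%:E)%E.
  pose m := #|` (thicken (F j) E `\` F j)%fset|.
  have Fj : 0 < #|` F j|%:R :> R by rewrite ltr0n cardfs_gt0.
  (* With no patterns the left side is -oo; otherwise both logarithms are finite. *)
  have [p0|p0] := posnP #|patterns X (F j)|.
    rewrite p0 le0_lneNy ?lexx// inver gt_eqF// mulNyr gtr0_sg ?invr_gt0//.
    by rewrite mul1e leNye.
  have pq : (#|patterns X (F j)| <= #|patterns Y (F j)| * #|B|.+1 ^ m)%N.
    apply: (leq_trans (XY _)); apply: (leq_trans (card_patterns_fsetD _ _ (F j))).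
    by rewrite leq_mul// -/m; case: m => [|n]//; rewrite leq_exp2r.
  have q0 : (0 < #|patterns Y (F j)|)%N.
    by move: (leq_trans p0 pq); rewrite muln_gt0 => /andP[].
  rewrite !lne_EFin ?ltr0n// inver gt_eqF// -!EFinM -EFinD lee_fin.
  rewrite /k -/m mulrA -mulrDl ler_pM2r ?invr_gt0//.
  rewrite /c mulr_natr -lnXn ?ltr0n// -lnM ?posrE ?exprn_gt0 ?ltr0n//.
  by rewrite ler_ln ?posrE ?mulr_gt0 ?exprn_gt0 ?ltr0n// -natrX -natrM ler_nat.
have ck : (fun j => c * k j) @ net_filter J --> (0 : R).
  by rewrite -(mulr0 c); apply: cvgMr; exact: FE.
apply: limf_esup_le_near => e e0.
apply: filterS (cvgr_lt 0 ck e e0) => j cke.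
by apply: (le_trans (step j)); rewrite leeD2l// lee_fin ltW.
Qed.

Theorem theorem5p1 (R : realType) (G : groupType) (d : Order.disp_t)
    (J : preorderType d) (F : J -> {fset G}) (A B : finType)
    (X : set (config G A)) (Y : set (config G B)) (tau : X -> Y) :
  amenable R G ->
  Folner_net R F ->
  subshift X ->
  subshift Y ->
  strongly_irreducible X ->
  cellular_automaton tau ->
  pre_injective tau ->
  entropy R F (range (fun x : X => set_val (tau x))) = entropy R F X.
Proof.
move=> _ folF shX _ irrX caX preX.
pose tv (u : X) : config G B := set_val (tau u).
have [M tauM] := local_rule shX caX.
have tau_far (u v : X) W : (forall h, h \notin W ->
      (set_val u : config G A) h = (set_val v : config G A) h) ->
    forall g, g \notin thicken W M -> tv u g = tv v g.
  move=> uv g gWM; apply: tauM => m mM; apply: uv; apply: contra gWM => gmW.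
  by apply/thickenP; exists m.
apply/eqP; rewrite eq_le; apply/andP; split.
  (* The image on [W] depends only on the sites of W M, which is [thicken] of [W] by the inverses of
     [M]. *)
  apply: (entropy_le_thicken (E := [fset m^-1%g | m in M]%fset) folF) => W.
  apply: (card_le_rel (r := fun p q => exists2 u : X,
    restr W (tv u) = p & restr _ (set_val u) = q)).
    move=> _ /set_mem[_ [u _ <-] <-]; exists (restr _ (set_val u)); last by exists u.
    by apply/mem_set; exists (set_val u) => //; exact: set_valP.
  move=> _ _ _ [u <- <-] [v <- /restr_eqP vu].
  apply/restr_eqP => g gW; apply: tauM => m mM; rewrite vu//.
  apply/thickenP; exists m^-1%g; last by rewrite mulgK.
  exact: in_imfset.
have [D extD] := strongly_irreducible_extend shX.1 irrX.
(* The reverse inequality uses a fixed background point [x0], so empty [X] is treated apart. *)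
have [X_0|/set0P[x0 X0]] := eqVneq X set0.
  apply: (entropy_le_thicken (E := fset0) folF) => W.
  by rewrite eq_card0// => p; apply/negP => /set_mem[x]; rewrite X_0.
(* Since W D^-1 M^-1 = W (M D)^-1, thickening by M D absorbs both enlargements. *)
pose E := [fset (m * e)%g | m in M, e in D]%fset.
apply: (entropy_le_thicken (E := E) folF) => W.
have thE : (thicken (thicken W D) M `<=` thicken W E)%fset.
  apply/fsubsetP => g /thickenP[m mM /thickenP[e eD gW]].
  apply/thickenP; exists (m * e)%g; last by rewrite mulgA.
  by apply/imfset2P; exists m => //; exists e.
(* Requiring [u] to equal [x0] off [thicken W D] makes any two such points differ on a finite set
   only, as pre-injectivity demands. *)
apply: (card_le_rel (r := fun p q => exists u : X,
  [/\ restr W (set_val u) = p, restr (thicken W E) (tv u) = q &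
   forall h, h \notin thicken W D -> (set_val u : config G A) h = x0 h])).
  move=> _ /set_mem[x1 X1 <-]; have [x [Xx xx1 xx0]] := extD W x1 x0 X1 X0.
  pose u : X := exist _ x (mem_set Xx).
  exists (restr (thicken W E) (tv u)).
    by apply/mem_set; exists (tv u) => //; exists u.
  by exists u; split => //; exact/restr_eqP.
move=> _ _ _ [u [<- <- uD]] [v [<- /restr_eqP vu vD]].
suff -> : u = v by [].
have uvD h : h \notin thicken W D ->
    (set_val u : config G A) h = (set_val v : config G A) h.
  by move=> hD; rewrite uD ?vD.
apply: preX; first by exists (thicken W D).
(* Inside [thicken W E] the images share the pattern [q]; outside it they agree by locality. *)
apply/val_inj/funext => g; have [gE|gE] := boolP (g \in thicken W E).
  by rewrite -[LHS]vu.
by apply: (tau_far _ _ _ uvD); apply: contra gE => /(fsubsetP thE).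
Qed.
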